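(* The limit points of $\lambda_{2,n}(3)$ are exactly $11$ and $13$; that is, $\{v:\lambda_{2,n}(3)=v\text{ for infinitely many odd } n>1\}=\{11,13\}$.
   Context: For an odd integer $n>1$, a representation of a positive integer $k$ (with respect to $2$ and $n$) is an expression $k=\sum_{j\ge 0}\varepsilon_j(2)2^j+\sum_{j\ge 0}\varepsilon_j(n)n^j$ with only finitely many nonzero coefficients, where $\varepsilon_j(2)\in\{0,\pm1\}$ and $\varepsilon_j(n)\in\{0,\pm1,\dots,\pm\lfloor n/2\rfloor\}$ are integers. Its length is $\sum_{j\ge 0}(|\varepsilon_j(2)|+|\varepsilon_j(n)|)$. For a positive integer $h$, $\lambda_{2,n}(h)$ denotes the smallest positive integer that has a representation of length $h$ but no representation of length less than $h$. For fixed $h$, a limit point of $\lambda_{2,n}(h)$ is a value that $\lambda_{2,n}(h)$ takes for infinitely many $n$ as $n$ runs over the odd integers greater than $1$. *)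

(* Defs.v *)
From mathcomp Require Import all_boot all_order all_algebra.
From mathcomp Require Import boolp classical_sets cardinality.

Set Implicit Arguments.
Unset Strict Implicit.
Unset Printing Implicit Defensive.

Import Order.TTheory GRing.Theory Num.Theory.
Local Open Scope ring_scope.

(* The finitely supported digit families are encoded as
   functions on nat that vanish from some index N on; the sums are then
   truncated at N, and their values do not depend on the choice of N. *)
Definition has_rep (n k l : nat) : Prop :=
  exists (e2 en : nat -> int) (N : nat),
    [/\ forall j, `|e2 j| <= 1,
        forall j, `|en j| <= (n./2)%:Z,
        forall j, (N <= j)%N -> e2 j = 0 /\ en j = 0,
        k%:Z = \sum_(j < N) e2 j * 2 ^+ j + \sum_(j < N) en j * n%:Z ^+ j
      & l = (\sum_(j < N) (`|e2 j| + `|en j|))%N].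

Definition has_min_length (n k h : nat) : Prop :=
  has_rep n k h /\ (forall l, (l < h)%N -> ~ has_rep n k l).

(* [is_lambda n h v] says that lambda_{2,n}(h) exists and equals v. *)
Definition is_lambda (n h v : nat) : Prop :=
  [/\ (0 < v)%N, has_min_length n v h
    & forall k, (0 < k)%N -> has_min_length n k h -> (v <= k)%N].

Lemma is_lambda_inj n h v w : is_lambda n h v -> is_lambda n h w -> v = w.
Proof.
move=> [v0 vh vmin] [w0 wh wmin].
by apply/eqP; rewrite eqn_leq vmin // wmin.
Qed.

Local Open Scope classical_set_scope.

Definition limit_points (h : nat) : set nat :=
  [set v | infinite_set [set n | [/\ odd n, (1 < n)%N & is_lambda n h v]]].

(* Main.v *)
(** A representation of length at most 2 is a sum of at most two terms [± 2^i],
    [± n^j]. All of 1, ..., 10 and 12 have one, while for large [n] the numbers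
    [k = 11] and [k = 13] have one only if [k = ± (n^j - 2^i)] with [j > 0].
    This excludes [k = 11] when [n = 1 mod 8] and allows it when [n = 2^m + 11].
    The point is that it cannot hold for 11 and 13 at once.  Modulo 8 one sees
    that both exponents of [n] are odd and that [x = n] or [x = - n] satisfies
    [x^j = 11 + s 2^m] and [x^j' = - 13 + s 2^m'] with the same sign [s].  Since
    [11^25 = (-13)^3 mod 2^10] and powers of [x = 3 mod 8] that agree modulo
    [2^10] have exponents that agree modulo [2^8], we get [25 j = 3 j' mod 2^8],
    hence [x^(25 j) = x^(3 j')] modulo the Fermat primes 17 and 257.  But there
    [s 2^m] takes few values, and
    [(11 + s 2^m)^25 = (- 13 + s 2^m')^3] has no solution modulo both primes. *)

Require Import Defs.
From mathcomp Require Import all_boot all_order all_algebra.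
From mathcomp Require Import boolp classical_sets cardinality.
From mathcomp Require Import finfield zify ring.

Import Order.TTheory GRing.Theory Num.Theory.
Local Open Scope ring_scope.

(** * Powers modulo 8 and modulo higher powers of 2 *)

Lemma expz_odd_mod8 (x : int) (j : nat) :
  (x %% 2 = 1)%Z -> (x ^+ j = x ^+ odd j %[mod 8])%Z.
Proof.
move=> x_odd; have [q ->] : exists q, x = 2 * q + 1 by exists (x %/ 2)%Z; lia.
have sqr : ((2 * q + 1) ^+ 2 = 1 %[mod 8])%Z.
  have [c qc] : exists c, q * (q + 1) = 2 * c.
    exists ((q * (q + 1)) %/ 2)%Z.
    have [] : (q %% 2 = 0 \/ q %% 2 = 1)%Z by lia.
      nia.
    nia.
  rewrite (_ : _ ^+ 2 = 4 * (q * (q + 1)) + 1); last by ring.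
  by rewrite qc; lia.
rewrite -{1}(odd_double_half j) exprD -muln2 mulnC exprM.
by rewrite -modzMmr -modzXm sqr modzXm expr1n modzMmr mulr1.
Qed.

(** Squaring [1 + 2^a w] with [w] odd and [a > 1] raises the exact power of 2 by one; the start is
    [x^2 - 1], which is 8 times an odd number. *)
Lemma exp_2power_residue (x : int) (k : nat) : (x %% 8 = 3)%Z ->
  exists u, x ^+ (2 ^ k.+1) = 1 + 2 ^+ (k + 3) * (2 * u + 1).
Proof.
move=> x3; elim: k => [|k [u IH]].
  have [t ->] : exists t, x = 8 * t + 3 by exists (x %/ 8)%Z; lia.
  by exists (4 * t ^+ 2 + 3 * t); rewrite expn1; ring.
rewrite expnSr exprM IH.
exists (u + 2 ^+ (k + 1) * (2 * u + 1) ^+ 2).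
have -> : (k.+1 + 3 = (k + 1) + 3)%N by lia.
have -> : (k + 3 = (k + 1) + 2)%N by lia.
by rewrite !exprD; set w := 2 ^+ k; ring.
Qed.

Lemma dvdn_of_exp_eq1_mod (x : int) (k d : nat) : (x %% 8 = 3)%Z ->
  (2 ^+ (k + 2) %| x ^+ d - 1)%Z -> (2 ^ k %| d)%N.
Proof.
move=> x3; elim: k => [|k IH]; first by rewrite dvd1n.
move=> dvd_d.
have /dvdnP[e def_d] : (2 ^ k %| d)%N.
  by apply: IH; apply: dvdz_trans dvd_d; rewrite dvdz_exp2l // leq_add2r.
have [e_odd|e_even] := boolP (odd e); last first.
  by rewrite def_d expnS dvdn_mul // dvdn2.
(* An odd [d] is settled modulo 8, since [exp_2power_residue] starts at the exponent 2. *)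
exfalso; case: k {IH} dvd_d def_d => [|k] dvd_d def_d.
  have := expz_odd_mod8 x d; rewrite def_d muln1 e_odd expr1.
  move: dvd_d; rewrite def_d muln1; lia.
have [u xu] := exp_2power_residue x k x3.
have def_e : e = (1 + 2 * e./2)%N by lia.
move: dvd_d; rewrite def_d mulnC exprM xu {}def_e exprD exprM expr1.
set y := 1 + _; set f := e./2.
have -> : (k.+2 + 2 = (k + 3).+1)%N by lia.
have y2 : (2 ^+ (k + 3).+1 %| y ^+ 2 - 1)%Z.
  apply/dvdzP; exists ((2 * u + 1) * (1 + 2 ^+ (k + 2) * (2 * u + 1))).
  rewrite /y (_ : (k + 3) = (k + 2).+1)%N; last by lia.
  by rewrite !exprS; set w := 2 ^+ _; ring.
(* As [y ^+ 2] is 1 for this modulus, the odd power of [y] reduces to [y], which is not 1. *)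
have -> : y * (y ^+ 2) ^+ f - 1 = (y - 1) + y * ((y ^+ 2) ^+ f - 1) by ring.
have y2f : (2 ^+ (k + 3).+1 %| y * ((y ^+ 2) ^+ f - 1))%Z.
  by apply: dvdz_mull; apply: dvdz_trans y2 _; rewrite subrX1 dvdz_mulr.
rewrite rpredDr // /y addrC addKr exprSr dvdz_mul2l ?expf_neq0 //.
lia.
Qed.

Lemma eqmod_of_exp_eqmod (x : int) (k a b : nat) : (x %% 8 = 3)%Z ->
  (x ^+ a = x ^+ b %[mod 2 ^+ (k + 2)])%Z -> (a = b %[mod 2 ^ k])%N.
Proof.
move=> x3; wlog le_ab : a b / (a <= b)%N.
  by move=> W eq_ab; case: (leqP a b) => [|/ltnW] le; [|symmetry]; apply: W.
move=> /eqP; rewrite eq_sym eqz_mod_dvd -(subnKC le_ab) exprD.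
rewrite -[X in _ - X]mulr1 -mulrBr Gauss_dvdzr; last first.
  rewrite coprimezXl ?coprimezXr //.
  apply/coprimezP; exists (- (x %/ 2)%Z, 1); rewrite /=; lia.
by move=> /(dvdn_of_exp_eq1_mod _ _ _ x3)/dvdnP[c ->]; rewrite addnC modnMDl.
Qed.

(** * Reduction modulo the Fermat primes 17 and 257 *)

Definition common_residue (s a b p : nat) : bool :=
  (11 + (-1) ^+ s * 2 ^+ a) ^+ 25 == (- 13 + (-1) ^+ s * 2 ^+ b) ^+ 3 :> 'F_p.

(** The order of 2 is 8 modulo 17 and 16 modulo 257, so both exponents matter only modulo 16 and a
    finite check decides. *)
Lemma no_common_residue (s a b : nat) :
  ~~ (common_residue s a b 17 && common_residue s a b 257).
Proof.
pose u (F : nzRingType) c t : F := (-1) ^+ c * 2 ^+ t.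
pose eq_in (F : comNzRingType) c t t' :=
  (11 + u F c t) ^+ 25 == (- 13 + u F c t') ^+ 3.
have no_sol : all (fun c => all (fun t => all (fun t' =>
    ~~ (eq_in 'F_17 c t t' && eq_in 'F_257 c t t'))
    (iota 0 16)) (iota 0 16)) (iota 0 2).
  by vm_compute.
have modE (p t : nat) : 2 ^+ 16 == 1 :> 'F_p -> 2 ^+ t = 2 ^+ (t %% 16) :> 'F_p.
  move=> /eqP p16.
  by rewrite {1}(divn_eq t 16) exprD mulnC exprM p16 expr1n mul1r.
have two17 : 2 ^+ 16 == 1 :> 'F_17 by vm_compute.
have two257 : 2 ^+ 16 == 1 :> 'F_257 by vm_compute.
have in_iota t n : (0 < n)%N -> (t %% n)%N \in iota 0 n.
  by move=> n0; rewrite mem_iota ltn_pmod.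
have /allP/(_ _ (in_iota s 2%N isT)) := no_sol.
move=> /allP/(_ _ (in_iota a 16%N isT))/allP/(_ _ (in_iota b 16%N isT)).
rewrite /common_residue /eq_in /u modn2 !signr_odd.
by rewrite -(modE _ _ two17) -(modE _ _ two257) -(modE _ b two17) -(modE _ b two257).
Qed.

(** Fermat's little theorem, with positive exponents to cover [X = 0]. It is applied with
    [c = 2 ^ 8], a multiple of both 16 and 256. *)
Lemma Fp_expr_eqmod (p c a b : nat) (X : 'F_p) : prime p -> (p.-1 %| c)%N ->
  (0 < a)%N -> (0 < b)%N -> (a = b %[mod c])%N -> X ^+ a = X ^+ b.
Proof.
move=> p_pr dvd_c a_gt0 b_gt0 eq_ab.
have [->|X0] := eqVneq X 0; first by rewrite !expr0n !gtn_eqF.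
have Xp : X ^+ p.-1 = 1.
  apply: (mulfI X0); rewrite -exprS prednK ?prime_gt0 // mulr1.
  by have := expf_card X; rewrite card_Fp.
have Xc : X ^+ c = 1.
  by have /dvdnP[q ->] := dvd_c; rewrite mulnC exprM Xp expr1n.
have expE t : X ^+ t = X ^+ (t %% c).
  by rewrite {1}(divn_eq t c) exprD mulnC exprM Xc expr1n mul1r.
by rewrite expE eq_ab -expE.
Qed.

Lemma pow11_pow13 : (11 ^+ 25 = (- 13) ^+ 3 %[mod 2 ^+ 10])%Z.
Proof.
have chain (x c d e m : int) : (x ^+ 5 = c %[mod m])%Z -> (c ^+ 2 = d %[mod m])%Z ->
    (d ^+ 2 = e %[mod m])%Z -> (x ^+ 25 = c * e %[mod m])%Z.
  move=> xc cd de; rewrite (exprM x 5 5) -modzXm xc modzXm (exprS c 4) (exprM c 2 2).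
  by rewrite -modzMmr -(modzXm 2 (c ^+ 2)) cd modzXm de modzMmr.
(* The residues of [11^5], [11^10] and [11^20] modulo 1024. *)
by rewrite (chain 11 283 217 (- 15)).
Qed.

Lemma no_simultaneous_powers (x : int) (s j j' m m' : nat) : (x %% 8 = 3)%Z ->
  (0 < j)%N -> (0 < j')%N -> (10 <= m)%N -> (10 <= m')%N ->
  x ^+ j = 11 + (-1) ^+ s * 2 ^+ m -> x ^+ j' = - 13 + (-1) ^+ s * 2 ^+ m' ->
  False.
Proof.
move=> x3 j_gt0 j'_gt0 m_ge m'_ge xj xj'.
have expE (y c M : int) (t e : nat) : (10 <= t)%N -> M = 2 ^+ 10 ->
    y = c + (-1) ^+ s * 2 ^+ t -> (y ^+ e = c ^+ e %[mod M])%Z.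
  move=> t_ge ME yE; rewrite -modzXm -[in RHS]modzXm; congr (_ ^+ e %% M)%Z.
  by rewrite yE -(subnK t_ge) exprD -ME mulrA addrC modzMDl.
have eq_exp : (j * 25 = j' * 3 %[mod 2 ^ 8])%N.
  apply: (eqmod_of_exp_eqmod _ 8 _ _ x3); rewrite [x ^+ _]exprM [x ^+ (j' * 3)]exprM.
  rewrite (expE _ _ _ m 25%N m_ge erefl xj) (expE _ _ _ m' 3%N m'_ge erefl xj').
  exact: pow11_pow13.
apply/negP: (no_common_residue s m m').
have redE p : prime p -> (p.-1 %| 2 ^ 8)%N -> common_residue s m m' p.
  move=> p_pr p_dvd; rewrite /common_residue; pose f (y : int) : 'F_p := y%:~R.
  have [fj fj'] : f (x ^+ j) = 11 + (-1) ^+ s * 2 ^+ m /\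
                  f (x ^+ j') = - 13 + (-1) ^+ s * 2 ^+ m'.
    by rewrite xj xj' /f !(rmorphD, rmorphM, rmorphXn, rmorphN) /=.
  rewrite -fj -fj' /f -!rmorphXn -!exprM /= !rmorphXn /=.
  by apply/eqP; apply: (Fp_expr_eqmod _ _ _ _ _ p_pr p_dvd);
    rewrite ?muln_gt0 ?j_gt0 ?j'_gt0.
by rewrite !redE.
Qed.

(** * Representations as sums of signed powers *)

Lemma digit_sum_terms (B : int) (e : nat -> int) (N : nat) :
  exists2 s : seq int,
    size s = (\sum_(j < N) `|e j|)%N /\ \sum_(a <- s) a = \sum_(j < N) e j * B ^+ j
    & forall a, a \in s -> exists c j : nat, a = (-1) ^+ c * B ^+ j.
Proof.
elim: N => [|N [s [size_s sum_s] s_terms]].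
  by exists [::]; rewrite ?big_ord0 ?big_nil.
exists (s ++ nseq `|e N| ((-1) ^+ (e N < 0)%R * B ^+ N)).
  rewrite size_cat size_nseq big_cat /= big_nseq !big_ord_recr /= size_s sum_s.
  split=> //; congr (_ + _); rewrite iter_addr_0 -mulr_natl mulrA.
  by rewrite natz [in RHS](intEsign (e N)); ring.
move=> a; rewrite mem_cat => /orP[/s_terms //|/nseqP[-> _]].
by exists (e N < 0)%R, N.
Qed.

(** Turns length into a number of summands: a digit [d] stands for [|d|] copies of one signed
    power. *)
Lemma has_rep_terms (n k l : nat) : has_rep n k l ->
  exists2 s : seq int, size s = l /\ \sum_(a <- s) a = k%:Z
    & forall a, a \in s -> exists c j : nat,
        a = (-1) ^+ c * 2 ^+ j \/ a = (-1) ^+ c * n%:Z ^+ j.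
Proof.
move=> [e2 [en [N [_ _ _ -> ->]]]].
have [s [size_s sum_s] s_terms] := digit_sum_terms 2 e2 N.
have [t [size_t sum_t] t_terms] := digit_sum_terms n en N.
exists (s ++ t); first by rewrite size_cat big_cat /= size_s sum_s size_t sum_t big_split.
move=> a; rewrite mem_cat => /orP[/s_terms|/t_terms] [c [j ->]]; exists c, j.
  by left.
by right.
Qed.

Lemma PoszX (b i : nat) : (b ^ i)%N%:Z = b%:Z ^+ i.
Proof. by rewrite -!natz natrX. Qed.

(** Made so that [k] is neither a signed power of [b] nor a sum of two: two positive exponents would
    force [b] to divide [k], and an exponent 0 would put a power of [b] next to [k]. *)
Definition isolated (b k : nat) :=
  ~~ (b %| k)%N /\ forall i : nat, [/\ b ^ i != k.-1, b ^ i != k & b ^ i != k.+1]%N.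

Lemma isolated_neq1 (b k c i : nat) : isolated b k ->
  (-1) ^+ c * b%:Z ^+ i <> k%:Z.
Proof.
move=> [_ /(_ i)[_ neq _]]; have := expn_gt0 b i; rewrite -PoszX -signr_odd.
case: (odd c); rewrite ?expr0 ?expr1; lia.
Qed.

Lemma isolated_neq2 (b k c i d j : nat) : isolated b k ->
  (-1) ^+ c * b%:Z ^+ i + (-1) ^+ d * b%:Z ^+ j <> k%:Z.
Proof.
move=> [ndvd neq].
wlog le_ij : c i d j / (i <= j)%N.
  by move=> W; case: (leqP i j) => [|/ltnW] le; last rewrite addrC; apply: W.
case: i le_ij => [|i] le_ij.
  have [] := neq j; rewrite -PoszX -(signr_odd _ c) -(signr_odd _ d).
  by case: (odd c); case: (odd d); rewrite ?expr0 ?expr1; lia.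
move=> eq_k; move/negP: ndvd; apply.
suff: (b%:Z %| k%:Z)%Z by [].
rewrite -eq_k; apply: rpredD; apply: dvdz_mull; rewrite dvdz_exp //; lia.
Qed.

Lemma isolated2 k : k \in [:: 11; 13]%N -> isolated 2 k.
Proof.
move=> k_in; split; first by move: k_in; rewrite !inE => /orP[]/eqP->.
case=> [|[|[|[|i]]]]; try by move: k_in; rewrite !inE => /orP[]/eqP->.
have : (16 <= 2 ^ i.+4)%N by rewrite (leq_pexp2l (m := 2) (n1 := 4)).
by move: k_in; rewrite !inE => /orP[]/eqP-> ?; split; lia.
Qed.

Lemma isolated_large (n k : nat) : (2 < k)%N -> (k.+1 < n)%N -> isolated n k.
Proof.
move=> k_gt2 k_lt; split; first by apply/negP => /dvdn_leq; lia.
case=> [|i]; first by rewrite expn0; split; lia.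
have : (n <= n ^ i.+1)%N by rewrite -{1}(expn1 n) leq_pexp2l //; lia.
by split; lia.
Qed.

(** Isolation rules out a single term and two powers of one base. In the remaining mixed sum the
    signs are opposite because [n ^+ j] exceeds [k]. *)
Lemma short_repE (n k l : nat) : isolated 2 k -> isolated n k ->
  (2 < k)%N -> (k.+1 < n)%N -> (l < 3)%N -> has_rep n k l ->
  exists s i j : nat, (0 < j)%N /\ k%:Z = (-1) ^+ s * (n%:Z ^+ j - 2 ^+ i).
Proof.
move=> iso2 ison k_gt2 k_lt l_lt3 /has_rep_terms[t [size_t sum_t] terms].
have mixed c i d j : (-1) ^+ c * 2 ^+ i + (-1) ^+ d * n%:Z ^+ j = k%:Z ->
    exists s i j : nat, (0 < j)%N /\ k%:Z = (-1) ^+ s * (n%:Z ^+ j - 2 ^+ i).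
  (* For [j = 0] the power of [n] is 1, also a power of 2. *)
  case: j => [|j] eq_k.
    by case: (isolated_neq2 2 k c i d 0 iso2).
  exists d, i, j.+1; split=> //; rewrite -eq_k.
  have ge_n : (n <= n ^ j.+1)%N by rewrite -{1}(expn1 n) leq_pexp2l //; lia.
  move: eq_k; rewrite -(PoszX 2) -PoszX.
  rewrite -(signr_odd _ c) -(signr_odd _ d).
  by case: (odd c); case: (odd d); rewrite ?expr0 ?expr1; lia.
case: t size_t sum_t terms => [|a [|b [|? t]]] /= size_t; try lia.
- by rewrite big_nil; lia.
- rewrite big_seq1 => sum_t /(_ a); rewrite mem_head => /(_ isT)[c [j [] aE]].
    by case: (isolated_neq1 2 k c j iso2); rewrite -aE.
  by case: (isolated_neq1 n k c j ison); rewrite -aE.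
rewrite big_cons big_seq1 => sum_t terms.
have [|c [i aE]] := terms a; first by rewrite !inE eqxx.
have [|d [j bE]] := terms b; first by rewrite !inE eqxx orbT.
case: aE => aE; case: bE => bE; move: sum_t; rewrite aE bE.
- by move/(isolated_neq2 2 k _ _ _ _ iso2).
- exact: mixed.
- by rewrite addrC; apply: mixed.
- by move/(isolated_neq2 n k _ _ _ _ ison).
Qed.

(** * Explicit representations *)

Lemma has_rep_pow2_digits (n k : nat) (s : seq int) :
  all (fun d => `|d| <= 1) s -> k%:Z = \sum_(j < size s) s`_j * 2 ^+ j ->
  has_rep n k (\sum_(j < size s) `|nth 0%R s j|)%N.
Proof.
move=> /allP s_digits kE; exists (nth 0 s), (fun=> 0), (size s); split.
- move=> j; have [j_lt|j_ge] := ltnP j (size s); last by rewrite nth_default.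
  exact/s_digits/mem_nth.
- by move=> j; rewrite normr0.
- by move=> j j_ge; rewrite nth_default.
- by rewrite kE [X in _ + X]big1 ?addr0 // => j _; rewrite mul0r.
- by apply: eq_bigr => j _; rewrite addn0.
Qed.

Lemma has_rep_diff (n m k : nat) : (1 < n)%N -> n%:Z - 2 ^+ m = k%:Z -> has_rep n k 2.
Proof.
move=> n_gt1 kE.
have sum_at (R : nmodType) (F : nat -> R) t : (t < m.+2)%N ->
    (forall j, j != t -> F j = 0) -> \sum_(j < m.+2) F j = F t.
  move=> t_lt F0; rewrite (bigD1 (Ordinal t_lt)) //= big1 ?addr0 // => j ne_jt.
  exact: F0.
(* The bound [m.+2] leaves room for position [m] and, even when [m = 0], for position 1. *)
exists (fun j => if j == m then -1 else 0), (fun j => if j == 1%N then 1 else 0), m.+2;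
  split.
- by move=> j; case: ifP; rewrite ?normr0 ?normrN ?normr1.
- by move=> j; case: ifP => _; rewrite ?normr0 ?normr1; lia.
- by move=> j j_ge; split; case: ifP => //; lia.
- rewrite (sum_at _ (fun j => (if j == m then -1 else 0) * 2 ^+ j) m) //; last first.
    by move=> j /negbTE->; rewrite mul0r.
  rewrite (sum_at _ (fun j => (if j == 1%N then 1 else 0) * n%:Z ^+ j) 1%N) //; last first.
    by move=> j /negbTE->; rewrite mul0r.
  by rewrite !eqxx -kE expr1 mul1r mulN1r addrC.
- rewrite big_split /=.
  rewrite (sum_at _ (fun j => `|(if j == m then -1 else 0)%R : int|%N) m) //; last first.
    by move=> j /negbTE->.
  rewrite (sum_at _ (fun j => `|(if j == 1 then 1 else 0)%R : int|%N) 1%N) //; last first.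
    by move=> j /negbTE->.
  by rewrite eqxx.
Qed.

(** * For large [n], 11 and 13 are not both short *)

Lemma pow2_exponent_ge (n i j k s : nat) : (2000 < n)%N -> (0 < j)%N -> (k < 100)%N ->
  k%:Z = (-1) ^+ s * (n%:Z ^+ j - 2 ^+ i) -> (10 <= i)%N.
Proof.
move=> n_gt j_gt0 k_lt kE; rewrite leqNgt; apply/negP => i_lt.
(* [2 ^ i] is within 100 of [n ^ j > 2000], hence above 1024. *)
have ge_n : (n <= n ^ j)%N by rewrite -{1}(expn1 n) leq_pexp2l //; lia.
have le_1024 : (2 ^ i <= 2 ^ 10)%N by rewrite leq_pexp2l // ltnW.
have e1024 : (2 ^ 10 = 1024)%N by [].
move: kE; rewrite -(PoszX 2) -PoszX -signr_odd.
by case: (odd s); rewrite ?expr0 ?expr1; lia.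
Qed.

Lemma pow2_mod8 (i : nat) : (10 <= i)%N -> (2 ^+ i %% 8 = 0 :> int)%Z.
Proof.
move=> i_ge; rewrite -(subnK (leq_trans (isT : 3 <= 10)%N i_ge)) exprD.
by rewrite (_ : 2 ^+ 3 = 8) // modzMl.
Qed.

Lemma rep_11_13_not_both_short (n l l' : nat) : odd n -> (2000 < n)%N ->
  (l < 3)%N -> (l' < 3)%N -> has_rep n 11 l -> has_rep n 13 l' -> False.
Proof.
move=> n_odd n_gt l_lt l'_lt rep11 rep13.
have iso k := isolated_large n k.
have [||||s [i [j [j_gt0 eq11]]]] := short_repE _ _ _ _ _ _ _ l_lt rep11; try lia.
- exact: isolated2.
- by apply: iso; lia.
have [||||t [i' [j' [j'_gt0 eq13]]]] := short_repE _ _ _ _ _ _ _ l'_lt rep13; try lia.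
- exact: isolated2.
- by apply: iso; lia.
have i_ge : (10 <= i)%N by apply: pow2_exponent_ge eq11; lia.
have i'_ge : (10 <= i')%N by apply: pow2_exponent_ge eq13; lia.
have n2 : (n%:Z %% 2 = 1)%Z by lia.
have mod8 e := expz_odd_mod8 n e n2.
have nj := mod8 j; have nj' := mod8 j'.
have i8 := pow2_mod8 i i_ge; have i'8 := pow2_mod8 i' i'_ge.
have sgn b (z : int) : (-1) ^+ b * z = if odd b then - z else z.
  by rewrite -signr_odd; case: (odd b); rewrite ?expr0 ?expr1 ?mulN1r ?mul1r.
rewrite !sgn in eq11 eq13.
(* An even exponent would give [n ^+ j = 1] modulo 8, whereas neither 11 nor 13 is 1 or -1 there. *)
have j_odd : odd j.
  apply: contraT => /negbTE j_even; move: nj eq11; rewrite j_even expr0.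
  by case: (odd s); lia.
have j'_odd : odd j'.
  apply: contraT => /negbTE j'_even; move: nj' eq13; rewrite j'_even expr0.
  by case: (odd t); lia.
rewrite j_odd j'_odd expr1 in nj nj'.
have sgnX e : odd e -> ((-1) ^+ s * n%:Z) ^+ e = (-1) ^+ s * n%:Z ^+ e.
  by move=> e_odd; rewrite exprMn -exprM -(signr_odd _ (s * e)) oddM e_odd andbT signr_odd.
(* Modulo 8, [(-1) ^+ s * n] is 3 and [(-1) ^+ t * n] is 5, so [s] and [t] have opposite parity;
   this turns 13 into -13. *)
apply: (no_simultaneous_powers ((-1) ^+ s * n%:Z) s j j' i i') => //.
- by move: eq11; rewrite sgn; case: (odd s); lia.
- by rewrite sgnX // !sgn; move: eq11; case: (odd s); lia.
- rewrite sgnX // !sgn; move: eq11 eq13.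
  by case: (odd s); case: (odd t); lia.
Qed.

(** * The values of lambda at length 3 *)

Lemma short_of_lt13 (n k : nat) : (0 < k < 13)%N -> k != 11%N ->
  exists2 l, (l < 3)%N & has_rep n k l.
Proof.
move=> k_lt k_neq11.
have short (m : nat) (s : seq int) : all (fun d => `|d| <= 1) s ->
    m%:Z = \sum_(j < size s) s`_j * 2 ^+ j -> (\sum_(j < size s) `|nth 0%R s j| < 3)%N ->
    exists2 l, (l < 3)%N & has_rep n m l.
  by move=> s_digits kE s_lt; exists (\sum_(j < size s) `|nth 0%R s j|)%N => //;
    exact: has_rep_pow2_digits.
(* Entry [k] lists signed binary digits of [k], lowest first, with [7 = 8 - 1]; entries 0 and 11 are
   fillers. *)
pose bits : seq (seq int) := [:: [::]; [:: 1]; [:: 0; 1]; [:: 1; 1]; [:: 0; 0; 1];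
  [:: 1; 0; 1]; [:: 0; 1; 1]; [:: -1; 0; 0; 1]; [:: 0; 0; 0; 1]; [:: 1; 0; 0; 1];
  [:: 0; 1; 0; 1]; [::]; [:: 0; 0; 1; 1]].
apply: (short _ (nth [::] bits k)); move: k_lt k_neq11;
  do 13 (case: k => [|k]; first by rewrite /= ?big_ord_recl ?big_ord0); lia.
Qed.

Lemma is_lambda3_11 (n : nat) :
  (forall l, (l < 3)%N -> ~ has_rep n 11 l) -> is_lambda n 3 11.
Proof.
move=> long11; split=> //.
  split=> //; have := has_rep_pow2_digits n 11 [:: 1; 1; 0; 1].
  by rewrite /= !big_ord_recl !big_ord0; apply.
move=> k k_gt0 [_ long_k]; rewrite leqNgt; apply/negP => k_lt.
by have [||l /long_k long /long] := short_of_lt13 n k; lia.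
Qed.

Lemma is_lambda3_13 (n l : nat) : (l < 3)%N -> has_rep n 11 l ->
  (forall l', (l' < 3)%N -> ~ has_rep n 13 l') -> is_lambda n 3 13.
Proof.
move=> l_lt short11 long13; split=> //.
  split=> //; have := has_rep_pow2_digits n 13 [:: 1; 0; 1; 1].
  by rewrite /= !big_ord_recl !big_ord0; apply.
move=> k k_gt0 [_ long_k]; rewrite leqNgt; apply/negP => k_lt.
have [k11|k_neq11] := eqVneq k 11%N; first by case: (long_k l l_lt); rewrite k11.
by have [||l' /long_k long /long] := short_of_lt13 n k; lia.
Qed.

(** * Limit points *)

Lemma infinite_setP_nat (A : set nat) :
  infinite_set A <-> forall N, exists2 n, (N < n)%N & A n.
Proof.
split=> [A_inf N|A_unbounded A_fin].
  apply: contrapT => A_le; apply: A_inf.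
  apply: (sub_finite_set _ (finite_II N.+1)) => n An /=.
  by rewrite ltnS leqNgt; apply/negP => N_lt; apply: A_le; exists n.
have [s As] := (finite_seqP A).1 A_fin.
have [n n_gt] := A_unbounded (\max_(i <- s) i).
rewrite As /= => n_in; move: n_gt; rewrite ltnNge.
by rewrite (leq_bigmax_seq (F := id) _ n_in).
Qed.

Lemma is_lambda3_eq_11_or_13 (n v : nat) : odd n -> (2000 < n)%N ->
  is_lambda n 3 v -> v = 11%N \/ v = 13%N.
Proof.
move=> n_odd n_gt lam_v.
have [[l l_lt short11]|long11] := pselect (exists2 l, (l < 3)%N & has_rep n 11 l).
  right; apply: is_lambda_inj lam_v _; apply: (is_lambda3_13 _ _ l_lt short11) => l' l'_lt.
  by apply: rep_11_13_not_both_short l_lt l'_lt short11.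
left; apply: is_lambda_inj lam_v _; apply: is_lambda3_11 => l l_lt short11.
by apply: long11; exists l.
Qed.

(** A short form would make 11 equal to 1 or -1 modulo 8, because the power of 2 vanishes there. *)
Lemma is_lambda3_11_of_mod8 (n : nat) : (2000 < n)%N -> (n = 1 %[mod 8])%N ->
  is_lambda n 3 11.
Proof.
move=> n_gt n1; apply: is_lambda3_11 => l l_lt short11.
have [||||s [i [j [j_gt0 eq11]]]] := short_repE n _ _ _ _ _ _ l_lt short11; try lia.
- exact: isolated2.
- by apply: isolated_large; lia.
have i8 : (2 ^+ i %% 8 = 0 :> int)%Z.
  by apply: pow2_mod8; apply: pow2_exponent_ge eq11.
have nj : (n%:Z ^+ j = 1 %[mod 8])%Z.
  have n8 : (n%:Z = 1 %[mod 8])%Z by lia.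
  by rewrite -modzXm n8 modzXm expr1n.
move: eq11; rewrite -signr_odd; case: (odd s); rewrite ?expr0 ?expr1; lia.
Qed.

(** [n - 2 ^ m = 11] makes 11 short, so 13 cannot be; [m > 10] brings [n] above 2000. *)
Lemma is_lambda3_13_of_pow2 (m : nat) : (10 < m)%N -> is_lambda (2 ^ m + 11) 3 13.
Proof.
move=> m_gt; set n := (2 ^ m + 11)%N.
have n_gt : (2000 < n)%N.
  have : (2 ^ 11 <= 2 ^ m)%N by rewrite leq_pexp2l.
  by rewrite (_ : 2 ^ 11 = 2048)%N // /n; lia.
have n_odd : odd n by rewrite /n oddD oddX; lia.
have short11 : has_rep n 11 2.
  apply: (has_rep_diff _ m); first by lia.
  by rewrite /n PoszD PoszX addrC addKr.
apply: (is_lambda3_13 _ 2 _ short11) => // l l_lt.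
exact: (rep_11_13_not_both_short n 2 l n_odd n_gt _ l_lt short11).
Qed.

Local Close Scope ring_scope.
Local Open Scope classical_set_scope.

Theorem corollary2 : limit_points 3 = [set 11; 13]%N.
Proof.
apply/seteqP; split=> v /=.
  move=> /infinite_setP_nat/(_ 2000)[n n_gt [n_odd _ lam_v]].
  exact: is_lambda3_eq_11_or_13 n_odd n_gt lam_v.
case=> ->; apply/infinite_setP_nat => N.
  exists (8 * (N + 2000) + 1); first by lia.
  by split; [lia | lia | apply: is_lambda3_11_of_mod8; lia].
exists (2 ^ (N + 11) + 11); first by have := ltn_expl (N + 11) (isT : 1 < 2); lia.
split; first by rewrite oddD oddX; lia.
- by lia.
- by apply: is_lambda3_13_of_pow2; lia.
Qed.
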